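(* There is a unique function $G\mapsto C(G,s,t)\in\mathbb{Z}[s,t]$ on finite graphs (including the empty graph $\phi$) satisfying (1) $C(G)=C(G-e)+tC(G/e)-tC(G-u)-tC(G-v)+tC(G-u-v)$ for every edge $e$ of $G$ with distinct endpoints $u\neq v$; (2) $C(G_1+G_2)=C(G_1)C(G_2)$ for disjoint unions of nonempty graphs; (3) $C(K_1^n)=1+nst$ for $n\geq 0$, and $C(\phi)=1$; and for every graph $G$ and all $k,l$, the coefficient of $s^kt^l$ in $C(G,s,t)$ equals $c_{k,l}(G)$, the number of $k$-components $l$-length cycles of $G$.
   Context: Graphs are finite triples $G=(V,E,\varphi)$ with loops and multiple edges allowed, $\varphi$ mapping each edge to an unordered pair of (possibly equal) vertices; $\phi$ is the empty graph. Degrees count loops twice. A $k$-components $l$-length cycle of $G$ is a subgraph (possibly empty) with exactly $k$ connected components and $l$ edges in which every vertex has degree $2$; these are counted as subgraphs. $K_1^n$ is the graph with one vertex and $n$ loops. For an edge $e$ with endpoints $u\neq v$: $G-e$ deletes $e$; $G/e$ deletes $e$ and identifies $u$ and $v$ (other edges between $u$ and $v$ become loops); $G-u$ deletes $u$ and its incident edges; $G-u-v$ deletes $u$, $v$ and their incident edges. *)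

(* Defs.v *)
From HB Require Import structures.
From mathcomp Require Import all_boot all_order all_algebra.
From mathcomp Require Import mpoly.

Set Implicit Arguments.
Unset Strict Implicit.
Unset Printing Implicit Defensive.

Import GRing.Theory.
Local Open Scope ring_scope.

(* An unordered pair of possibly equal vertices is encoded as a vertex set of
   cardinality 1 (a loop) or 2. *)
Record graph : Type := Graph {
  vert : finType;
  edge : finType;
  ends : edge -> {set vert};
  endsP : forall e, (0 < #|ends e| <= 2)%N }.

Lemma imset_ends (T U : finType) (f : T -> U) (A : {set T}) :
  (0 < #|A| <= 2 -> 0 < #|f @: A| <= 2)%N.
Proof.
case/andP=> A0 A2; rewrite (leq_trans (leq_imset_card _ _) A2) andbT.
by move: A0; rewrite !card_gt0; apply: contraNneq => /eqP; rewrite imset_eq0.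
Qed.

Section Operations.
Variable G : graph.

Definition del_edge (e : edge G) : graph :=
  @Graph (vert G) {f : edge G | f != e}
    (fun f => ends (val f)) (fun f => endsP (val f)).

(* [insub x] is [None] when [x] is an endpoint of [e] and [Some x] otherwise:
   [None] is the vertex obtained by identifying the endpoints of [e]. *)
Definition contract_vert (e : edge G) (x : vert G) :
  option {x : vert G | x \notin ends e} := insub x.

Definition contract (e : edge G) : graph :=
  @Graph (option {x : vert G | x \notin ends e}) {f : edge G | f != e}
    (fun f => contract_vert e @: ends (val f))
    (fun f => imset_ends (contract_vert e) (endsP (val f))).

Definition del_verts_ends (D : {set vert G})
    (f : {f : edge G | [disjoint ends f & D]}) :
  {set {x : vert G | x \notin D}} := [set x | val x \in ends (val f)].

Lemma del_verts_endsP (D : {set vert G}) f :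
  (0 < #|@del_verts_ends D f| <= 2)%N.
Proof.
suff -> : #|del_verts_ends f| = #|ends (val f)| by apply: endsP.
rewrite -(card_imset _ val_inj); apply: eq_card => x; apply/imsetP/idP.
  by case=> y; rewrite inE => ? ->.
move=> xf; have xD : x \notin D by rewrite (disjointFr (valP f)).
by exists (Sub x xD); rewrite ?inE.
Qed.

Definition del_verts (D : {set vert G}) : graph := Graph (@del_verts_endsP D).

End Operations.

Definition gsum_ends (G1 G2 : graph) (e : edge G1 + edge G2) :
    {set vert G1 + vert G2} :=
  match e with
  | inl e1 => inl @: ends e1
  | inr e2 => inr @: ends e2
  end.

Lemma gsum_endsP (G1 G2 : graph) e : (0 < #|@gsum_ends G1 G2 e| <= 2)%N.
Proof. by case: e => e; apply: imset_ends; apply: endsP. Qed.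

Definition gsum (G1 G2 : graph) : graph := Graph (@gsum_endsP G1 G2).

Lemma bouquet_endsP n (e : 'I_n) : (0 < #|[set tt]| <= 2)%N.
Proof. by rewrite cards1. Qed.

Definition K1 (n : nat) : graph := Graph (@bouquet_endsP n).

Lemma empty_endsP (e : void) : (0 < #|of_void {set void} e| <= 2)%N.
Proof. by case: e. Qed.

Definition empty_graph : graph := Graph empty_endsP.

Definition iso (G H : graph) : Prop :=
  exists (f : vert G -> vert H) (g : edge G -> edge H),
    [/\ bijective f, bijective g & forall e, ends (g e) = f @: ends e].

Section Cycles.
Variable G : graph.

(* A subgraph is a pair (A, B) of a vertex set and an edge set such that A
   contains the endpoints of all edges in B. *)
Definition is_subgraph (S : {set vert G} * {set edge G}) : bool :=
  [forall e in S.2, ends e \subset S.1].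

Definition sub_degree (S : {set vert G} * {set edge G}) (x : vert G) : nat :=
  (\sum_(e in S.2 | x \in ends e) if #|ends e| == 1 then 2 else 1)%N.

Definition sub_adj (S : {set vert G} * {set edge G}) : rel (vert G) :=
  [rel x y | [exists e in S.2, ends e == [set x; y]]].

Definition is_cycle (k l : nat) (S : {set vert G} * {set edge G}) : bool :=
  [&& is_subgraph S,
      [forall x in S.1, sub_degree S x == 2%N],
      n_comp (sub_adj S) S.1 == k
    & #|S.2| == l].

Definition cycle_count (k l : nat) : nat := #|[set S | is_cycle k l S]|.

End Cycles.

Definition var_s : {mpoly int[2]} := 'X_(@Ordinal 2 0 isT).
Definition var_t : {mpoly int[2]} := 'X_(@Ordinal 2 1 isT).

(* "G is a disjoint union of G1 and G2", "G is a K_1^n" and "G is empty" are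
   read up to isomorphism; invariance of C under isomorphism is not assumed
   separately, since it follows from these conditions. *)
Definition cycle_recursion (C : graph -> {mpoly int[2]}) : Prop :=
  [/\ forall (G : graph) (e : edge G) (u v : vert G),
        u != v -> ends e = [set u; v] ->
        C G = C (del_edge e) + var_t * C (contract e)
              - var_t * C (del_verts [set u]) - var_t * C (del_verts [set v])
              + var_t * C (del_verts [set u; v]),
      forall G G1 G2 : graph,
        (0 < #|vert G1|)%N -> (0 < #|vert G2|)%N ->
        iso G (gsum G1 G2) -> C G = C G1 * C G2,
      forall (G : graph) (n : nat), iso G (K1 n) -> C G = 1 + n%:R * var_s * var_t
    & forall G : graph, iso G empty_graph -> C G = 1].

(* Main.v *)
(* Since a cycle is determined by its edges, take C(G) to be the sum of
   s^(components) t^(edges) over the edge sets B in which every vertex has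
   degree 0 or 2. For an edge e = uv, the sets B containing e correspond, by
   removing e, to the sets B' of G/e with degrees (1, 1) at (u, v). The other
   sets of G/e, which have degree 0 at u or at v, are those of G - u or of
   G - v, and both at once when they come from G - u - v; this gives (1) by
   inclusion-exclusion.
   For uniqueness, induct on the number of vertices and edges: (1) removes an
   edge with distinct endpoints, and a graph having only loops is a disjoint
   union of bouquets. *)
From Stdlib Require Import FunctionalExtensionality.
Require Import Defs.
From mathcomp Require Import all_boot all_order all_algebra.
From mathcomp Require Import mpoly.
From mathcomp Require Import zify ring.

Set Implicit Arguments.
Unset Strict Implicit.
Unset Printing Implicit Defensive.

Import GRing.Theory.

(** * Degrees, coverage and connectivity of edge sets *)

Section EdgeSets.
Variable G : graph.
Implicit Types (B : {set edge G}) (f : edge G) (x y : vert G).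

Definition covered B : {set vert G} := \bigcup_(f in B) ends f.

Definition spanned B : {set vert G} * {set edge G} := (covered B, B).

Definition degree B x : nat := sub_degree (spanned B) x.

(** Degree 0 is allowed because the test runs over all of [vert G], including the vertices that [B]
    misses. *)
Definition regular B : bool := [forall x, degree B x \in [:: 0; 2]].

Definition ncomp B : nat := n_comp (sub_adj (spanned B)) (covered B).

Definition weight B : {mpoly int[2]} :=
  (var_s ^+ ncomp B * var_t ^+ #|B|)%R.

Definition incidence f x : nat :=
  if x \in ends f then (if #|ends f| == 1 then 2 else 1) else 0.

Lemma ends_pair f : exists a b, ends f = [set a; b].
Proof.
have /andP[f0] := endsP f; rewrite leq_eqVlt => /predU1P[/eqP/cards2P[a [b [_ ->]]]|f1].
  by exists a, b.
have /cards1P[a ->] : #|ends f| == 1 by rewrite eqn_leq -ltnS f1.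
by exists a, a; rewrite setUid.
Qed.

(** The case [a = b] is included: the sum is then the 2 that a loop contributes. Loops therefore
    need no separate treatment in what follows. *)
Lemma incidence_pair f a b x :
  ends f = [set a; b] -> incidence f x = (x == a) + (x == b).
Proof.
rewrite /incidence => ->; rewrite cards2 !inE [a == b]eq_sym.
have [->|xa] := eqVneq x a; first by rewrite [b == a]eq_sym; case: eqP.
by have [<-|//] := eqVneq x b; rewrite xa.
Qed.

Lemma degreeE B x : degree B x = \sum_(f in B) incidence f x.
Proof. by rewrite /degree /sub_degree /= -big_mkcondr. Qed.

Lemma incidence_eq0 f x : (incidence f x == 0) = (x \notin ends f).
Proof. by rewrite /incidence; case: (x \in _) => //; case: ifP. Qed.

Lemma degree_eq0P B x :
  reflect (forall f, f \in B -> x \notin ends f) (degree B x == 0).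
Proof.
rewrite degreeE sum_nat_eq0; apply: (iffP forall_inP) => h f fB.
  by rewrite -incidence_eq0 h.
by rewrite incidence_eq0 h.
Qed.

Lemma coveredP B x : reflect (exists2 f, f \in B & x \in ends f) (x \in covered B).
Proof. exact: bigcupP. Qed.

Lemma degree_eq0 B x : (degree B x == 0) = (x \notin covered B).
Proof.
apply/degree_eq0P/idP => [h|/coveredP h f fB].
  by apply/coveredP=> -[f /h/negP].
by apply/negP=> xf; apply: h; exists f.
Qed.

Lemma sub_adj_sym B : ssrbool.symmetric (sub_adj (spanned B)).
Proof. by move=> x y; apply: eq_existsb => f; rewrite setUC. Qed.

Lemma connect_sub_adj_sym B : connect_sym (sub_adj (spanned B)).
Proof. exact/sym_connect_sym/sub_adj_sym. Qed.

Lemma sub_adjP B x y :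
  reflect (exists2 f, f \in B & ends f = [set x; y]) (sub_adj (spanned B) x y).
Proof.
apply: (iffP exists_inP) => -[f fB /eqP h]; exists f => //; exact/eqP.
Qed.

Lemma covered_closed B : closed (sub_adj (spanned B)) (covered B).
Proof.
move=> x y /sub_adjP[f fB fE].
have cov z : z \in [set x; y] -> z \in covered B.
  by rewrite -fE => zf; apply/coveredP; exists f.
by rewrite !cov // !inE eqxx ?orbT.
Qed.

Lemma connect_ends B f x y :
  f \in B -> x \in ends f -> y \in ends f -> connect (sub_adj (spanned B)) x y.
Proof.
move=> fB; have [a [b fE]] := ends_pair f.
have ab : connect (sub_adj (spanned B)) a b.
  by apply: connect1; apply/sub_adjP; exists f.
rewrite fE !inE => /orP[]/eqP-> /orP[]/eqP-> //.
by rewrite connect_sub_adj_sym.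
Qed.

End EdgeSets.

(** * Degrees and component counts along graph morphisms *)

Section Morphism.
Variables (G H : graph) (h : vert G -> vert H).

(** With [ends f = [set a; b]], both sides count how many of [a], [b] are sent to [y]. This stays
    true when [h] identifies [a] and [b] and turns [f] into a loop. *)
Lemma incidence_map (f : edge G) (f' : edge H) y :
  ends f' = h @: ends f -> incidence f' y = \sum_(x | h x == y) incidence f x.
Proof.
have [a [b fE]] := ends_pair f; rewrite fE imsetU1 imset_set1 => f'E.
have sum1 (c : vert G) : \sum_(x | h x == y) (x == c) = (y == h c).
  have [->|ne] := eqVneq y (h c).
    by rewrite (bigD1 c) //= eqxx big1 // => x /andP[_ /negPf->].
  rewrite big1 // => x /eqP hx; have [xc|//] := eqVneq x c.
  by rewrite -hx xc eqxx in ne.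
rewrite (incidence_pair _ f'E).
under eq_bigr do rewrite (incidence_pair _ fE).
by rewrite big_split /= !sum1.
Qed.

(* The fibres of [h] need only be connected in [A], and the edges of [A] may
   collapse: this allows [h] to contract an edge of [A]. *)
Lemma n_comp_morphism (A : {set edge G}) (B : {set edge H}) (b : {pred vert H}) :
  closed (sub_adj (spanned B)) b ->
  b \subset codom h ->
  (forall f' x, f' \in B -> x \in ends f' -> x \in b ->
     exists2 f, f \in A & ends f' = h @: ends f) ->
  (forall f x y, f \in A -> x \in ends f -> y \in ends f ->
     connect (sub_adj (spanned B)) (h x) (h y)) ->
  (forall x y, h x \in b -> h x = h y -> connect (sub_adj (spanned A)) x y) ->
  n_comp (sub_adj (spanned B)) b = n_comp (sub_adj (spanned A)) [preim h of b].
Proof.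
move=> clb bh lift_edge map_edge fibre.
apply: adjunction_n_comp; [exact: connect_sub_adj_sym..|exact: clb|].
split=> [x xb|x y xb].
  by exists (iinv (subsetP bh _ xb)); rewrite f_iinv.
apply/idP/idP.
  case/connectP=> p + ->.
  elim: p x {xb} => //= z p IHp x /andP[/sub_adjP[f fA fE] /IHp].
  by apply: connect_trans; apply: (map_edge f); rewrite // fE !inE eqxx ?orbT.
(* A path in [B] is lifted edge by edge. The lift of an edge has an end [x1] over the current
   vertex; [x1] is reached inside the fibre, and the lifted edge leads on to [x2]. *)
case/connectP=> p; elim: p x xb => /= [|z p IHp] x xb.
  by move=> _ /esym; apply: fibre.
case/andP=> xz zp yE; have zb : z \in b by rewrite -(clb _ _ xz).
case/sub_adjP: xz => f' f'B f'E.
have xf' : h x \in ends f' by rewrite f'E !inE eqxx.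
have zf' : z \in ends f' by rewrite f'E !inE eqxx orbT.
have [f fA] := lift_edge f' (h x) f'B xf' xb => eh.
rewrite eh in xf' zf'.
case/imsetP: xf' => x1 x1f hx1; case/imsetP: zf' => x2 x2f hx2.
rewrite {}hx2 in zb zp yE.
apply: connect_trans (fibre x x1 xb hx1) _.
apply: connect_trans (connect_ends fA x1f x2f) _.
exact: IHp.
Qed.

Lemma ncomp_morphism (A : {set edge G}) (B : {set edge H}) :
  (forall x, (h x \in covered B) = (x \in covered A)) ->
  (forall f', f' \in B -> exists2 f, f \in A & ends f' = h @: ends f) ->
  (forall f x y, f \in A -> x \in ends f -> y \in ends f ->
     connect (sub_adj (spanned B)) (h x) (h y)) ->
  (forall x y, x \in covered A -> h x = h y -> connect (sub_adj (spanned A)) x y) ->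
  ncomp B = ncomp A.
Proof.
move=> cov lift_edge map_edge fibre; rewrite /ncomp (@n_comp_morphism A).
- by apply: eq_card => x; rewrite !inE cov.
- exact: covered_closed.
- apply/subsetP=> y /coveredP[f' /lift_edge[f _ ->]] /imsetP[x _ ->].
  exact: codom_f.
- by move=> f' x /lift_edge.
- exact: map_edge.
- by move=> x y; rewrite cov; apply: fibre.
Qed.

Variables (g : edge G -> edge H) (A : {set edge G}).
Hypothesis g_inj : {in A &, injective g}.
Hypothesis g_ends : forall f, f \in A -> ends (g f) = h @: ends f.

Lemma degree_map y : degree (g @: A) y = \sum_(x | h x == y) degree A x.
Proof.
rewrite degreeE big_imset //=; under [RHS]eq_bigr do rewrite degreeE.
rewrite exchange_big; apply: eq_bigr => f fA.
exact/incidence_map/g_ends.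
Qed.

Hypothesis h_inj : injective h.

Lemma degree_embed x : degree (g @: A) (h x) = degree A x.
Proof.
rewrite degree_map (eq_bigl (pred1 x)) ?big_pred1_eq // => y.
exact: inj_eq.
Qed.

Lemma regular_embed : regular (g @: A) = regular A.
Proof.
apply/forallP/forallP=> reg x; first by rewrite -degree_embed.
(* Outside the image of [h] the degree is an empty sum, hence 0. *)
have [/codomP[y ->]|xh] := boolP (x \in codom h); first by rewrite degree_embed.
rewrite degree_map big_pred0 // => y; apply/eqP=> E.
by rewrite -E codom_f in xh.
Qed.

Lemma ncomp_embed : ncomp (g @: A) = ncomp A.
Proof.
apply: ncomp_morphism => [x|_ /imsetP[f fA ->]|f x y fA xf yf|x y _ /h_inj-> //].
- by apply: negb_inj; rewrite -!degree_eq0 degree_embed.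
- by exists f; rewrite ?g_ends.
- by apply: (@connect_ends _ _ (g f)); rewrite ?g_ends ?imset_f.
Qed.

Lemma weight_embed : weight (g @: A) = weight A.
Proof. by rewrite /weight ncomp_embed card_in_imset. Qed.

End Morphism.

Definition cycle_poly (G : graph) : {mpoly int[2]} :=
  (\sum_(B : {set edge G} | regular B) weight B)%R.

(** The edges of a graph obtained by deletion or contraction form a subtype of [edge G]. This turns
    sums over its edge sets into sums over edge sets of [G], where the terms of the recursion can be
    compared. *)
Lemma big_subset_val (T : finType) (P : pred T) (R : nmodType)
    (Q : pred {set T}) (F : {set T} -> R) :
  (\sum_(A : {set {x | P x}} | Q (val @: A)) F (val @: A) =
   \sum_(B | Q B && (B \subset P)) F B)%R.
Proof.
pose r (B : {set T}) : {set {x | P x}} := val @^-1: B.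
rewrite [RHS](reindex_onto (fun A : {set {x | P x}} => val @: A) r) /=.
  apply: eq_bigl => A; have -> : r (val @: A) = A.
    by apply/setP=> x; rewrite inE mem_imset //; apply: val_inj.
  rewrite eqxx andbT; have -> : val @: A \subset P; last by rewrite andbT.
  by apply/subsetP=> _ /imsetP[x _ ->]; apply: valP.
move=> B /andP[_ /subsetP BP]; apply/setP=> x; apply/imsetP/idP.
  by case=> y; rewrite inE => ? ->.
by move=> xB; exists (Sub x (BP x xB)); rewrite ?inE.
Qed.

(** * The deletion-contraction recursion *)

Section Recursion.
Variable G : graph.
Implicit Types (B : {set edge G}) (e f : edge G).

Lemma degree_setU1 e B x :
  e \notin B -> degree (e |: B) x = incidence e x + degree B x.
Proof. by move=> eB; rewrite !degreeE big_setU1. Qed.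

Lemma cycle_poly_del_edge e :
  cycle_poly (del_edge e) = (\sum_(B | regular B && (e \notin B)) weight B)%R.
Proof.
have emb (A : {set edge (del_edge e)}) (f : edge (del_edge e)) : f \in A ->
  @ends G (val f) = id @: @ends (del_edge e) f by rewrite imset_id.
have vi (A : {set edge (del_edge e)}) :
  {in A &, injective (val : edge (del_edge e) -> edge G)}.
  by move=> ? ? _ _; apply: val_inj.
transitivity (\sum_(A : {set edge (del_edge e)} | regular (val @: A : {set edge G}))
  weight (val @: A : {set edge G}))%R.
  apply: eq_big => A.
    by rewrite (regular_embed (@vi A) (emb A)) //; apply: inj_id.
  by rewrite (weight_embed (@vi A) (emb A)) //; apply: inj_id.
rewrite (@big_subset_val _ _ _ (fun B => regular B) (@weight G)).
apply: eq_bigl => B; congr (_ && _); apply/subsetP/idP => [sB|eB f fB].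
  by apply/negP=> /sB; rewrite unfold_in eqxx.
by rewrite unfold_in; apply: contraNneq eB => <-.
Qed.

Lemma ends_del_verts (D : {set vert G}) (f : edge (del_verts D)) :
  @ends G (val f) = val @: ends f.
Proof.
apply/setP=> x; apply/idP/imsetP=> [xf|[y]]; last by rewrite inE => ? ->.
have xD : x \notin D by rewrite (disjointFr (valP f)).
by exists (Sub x xD); rewrite ?inE.
Qed.

(** An edge set survives the deletion of [D] exactly when none of its edges meets [D], that is, when
    its degrees vanish on [D]. *)
Lemma cycle_poly_del_verts (D : {set vert G}) :
  cycle_poly (del_verts D) =
  (\sum_(B | regular B && [forall x in D, degree B x == 0%N]) weight B)%R.
Proof.
have vi (A : {set edge (del_verts D)}) :
  {in A &, injective (val : edge (del_verts D) -> edge G)}.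
  by move=> ? ? _ _; apply: val_inj.
transitivity (\sum_(A : {set edge (del_verts D)} | regular (val @: A : {set edge G}))
  weight (val @: A : {set edge G}))%R.
  apply: eq_big => A.
    by rewrite (regular_embed (@vi A) (fun a _ => ends_del_verts a)) //; apply: val_inj.
  by rewrite (weight_embed (@vi A) (fun a _ => ends_del_verts a)) //; apply: val_inj.
rewrite (@big_subset_val _ _ _ (fun B => regular B) (@weight G)).
apply: eq_bigl => B; congr (_ && _); apply/subsetP/forall_inP => [sB x xD|dB f fB].
  apply/degree_eq0P=> f /sB; rewrite unfold_in => fD.
  by apply/negP=> /(disjointFr fD); rewrite xD.
rewrite unfold_in disjoint_subset; apply/subsetP=> x xf; rewrite inE.
by apply/negP=> /dB/degree_eq0P/(_ f fB)/negP.
Qed.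

Lemma contract_vert_eq e x y :
  (contract_vert e x == contract_vert e y) =
  (if y \in ends e then x \in ends e else x == y).
Proof.
rewrite /contract_vert; case: insubP => [x' xe xE|xe]; case: insubP => [y' ye yE|ye];
  rewrite -?xE -?yE.
- by rewrite (negPf (valP y')).
- by move: ye xe; rewrite -xE => /negPn-> /negPf->.
- rewrite (negPf (valP y')); symmetry; apply/negbTE.
  by apply: contraNneq xe => ->; apply: (valP y').
- by rewrite eqxx; move: xe ye => /negPn-> /negPn->.
Qed.

Variables (e : edge G) (u v : vert G).
Hypotheses (uv : u != v) (eE : ends e = [set u; v]).

Lemma degree_contract (A : {set edge (contract e)}) x :
  degree A (contract_vert e x) =
  let B : {set edge G} := val @: A in
  if x \in ends e then degree B u + degree B v else degree B x.
Proof.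
have -> /= : degree A (contract_vert e x) =
  \sum_(y | contract_vert e y == contract_vert e x)
     degree (val @: A : {set edge G}) y.
  (* [del_edge e] and [contract e] have the same edges, so the contraction is a morphism from
     [del_edge e] that is [id] on edges. Degrees in [del_edge e] are then read in [G] through
     [val]. *)
  have := @degree_map (del_edge e) (contract e) (contract_vert e) id A.
  rewrite imset_id => -> //; apply: eq_bigr => y _; symmetry.
  apply: (@degree_embed (del_edge e) G id val A) => [f f' _ _|f _|//].
    exact: val_inj.
  by rewrite imset_id.
under eq_bigl do rewrite contract_vert_eq.
case: ifP => xe; last by rewrite big_pred1_eq.
by rewrite eE big_setU1 ?inE //= big_set1.
Qed.

(** Regularity in [contract e] read in [G]: the merged vertex collects the degrees of [u] and
    [v]. *)
Definition contract_regular B :=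
  (degree B u + degree B v \in [:: 0; 2]) &&
  [forall x, (x \notin ends e) ==> (degree B x \in [:: 0; 2])].

Lemma regular_contract (A : {set edge (contract e)}) :
  regular A = contract_regular (val @: A).
Proof.
have surj y : exists x, y = contract_vert e x.
  case: y => [x|]; first by exists (val x); rewrite /contract_vert valK.
  exists u; rewrite /contract_vert insubN // eE !inE eqxx //.
apply/forallP/andP => [reg|[reg1 /forall_inP reg2] y].
  split; last by apply/forall_inP=> x xe; have := reg (contract_vert e x);
    rewrite degree_contract /= (negPf xe).
  by have := reg (contract_vert e u); rewrite degree_contract eE !inE eqxx.
have [x ->] := surj y; rewrite degree_contract /=; case: ifPn => // xe.
exact: reg2.
Qed.

(** Since no edge of [A] meets [a], sending the merged vertex to [b] is an injection into [G] that
    respects the ends of all edges of [A]. *)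
Lemma weight_contract_embed (a b : vert G) (A : {set edge (contract e)}) :
  ends e = [set a; b] -> degree (val @: A : {set edge G}) a = 0 ->
  weight A = weight (val @: A : {set edge G}).
Proof.
move=> eab /eqP/degree_eq0P da.
pose h (y : vert (contract e)) : vert G := oapp val b y.
symmetry; apply: (@weight_embed _ _ h) => [f f' _ _|f fA|y y'].
- exact: val_inj.
- rewrite /= -imset_comp -[LHS]imset_id; apply: eq_in_imset => x xf /=.
  rewrite /h /contract_vert; case: insubP => [x' _ <- //|].
  rewrite negbK eab !inE => /orP[/eqP xa|/eqP-> //].
  by have := da (val f) (imset_f val fA); rewrite -xa xf.
- have be : b \in ends e by rewrite eab !inE eqxx orbT.
  rewrite /h; case: y y' => [y|] [y'|] //=; first by move/val_inj->.
    by move=> E; have := valP y; rewrite /= E be.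
  by move=> E; have := valP y'; rewrite /= -E be.
Qed.

(** The only fibre with more than one vertex is [ends e], and [e] itself connects it. The hypothesis
    excludes the case where [e] would be a component of its own, which the contraction would
    lose. *)
Lemma ncomp_contract_setU1 (A : {set edge (contract e)}) :
  degree (val @: A : {set edge G}) u + degree (val @: A : {set edge G}) v != 0 ->
  ncomp A = ncomp (e |: val @: A).
Proof.
move=> duv; have eA : e \notin val @: A.
  by apply/imsetP=> -[f _ E]; have := valP f; rewrite -E eqxx.
apply: (@ncomp_morphism G (contract e) (contract_vert e)) => [x|f fA|f x y|x y _ /eqP].
- apply: negb_inj; rewrite -!degree_eq0 degree_setU1 // degree_contract /=.
  rewrite /incidence; case: ifP => // xe.
  by rewrite (negPf duv); case: ifP.
- by exists (val f); rewrite // !inE imset_f ?orbT.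
- case/setU1P=> [->|/imsetP[f' f'A ->]] xf yf.
    by have /eqP-> : contract_vert e x == contract_vert e y;
      rewrite ?contract_vert_eq ?xf ?yf.
  by apply: (connect_ends f'A); apply: imset_f.
- rewrite contract_vert_eq; case: ifP => [ye xe|_ /eqP-> //].
  by apply: (@connect_ends _ _ e) => //; rewrite setU11.
Qed.

(** The weight in [contract e] read in [G]. If [B] meets both [u] and [v], the components are those
    of [B] with [e] put back, but the power of [var_t] does not count [e]; the factor [var_t] in the
    recursion makes up for it. *)
Definition contract_weight B : {mpoly int[2]} :=
  if (degree B u == 0) || (degree B v == 0) then weight B
  else (var_s ^+ ncomp (e |: B) * var_t ^+ #|B|)%R.

Lemma cycle_poly_contract :
  cycle_poly (contract e) =
  (\sum_(B | contract_regular B && (e \notin B)) contract_weight B)%R.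
Proof.
transitivity (\sum_(A : {set edge (contract e)} | contract_regular (val @: A))
  contract_weight (val @: A))%R.
  apply: eq_big => A; first exact: regular_contract.
  move=> _; rewrite /contract_weight; case: ifPn => [/orP[]/eqP d0|].
  - exact: weight_contract_embed eE d0.
  - by apply: (@weight_contract_embed v u) => //; rewrite setUC.
  rewrite negb_or => /andP[du0 _]; rewrite /weight ncomp_contract_setU1.
    by rewrite card_imset //; apply: val_inj.
  by rewrite addn_eq0 (negPf du0).
rewrite (@big_subset_val _ _ _ contract_regular contract_weight).
apply: eq_bigl => B; congr (_ && _); apply/subsetP/idP => [sB|eB f fB].
  by apply/negP=> /sB; rewrite unfold_in eqxx.
by rewrite unfold_in; apply: contraNneq eB => <-.
Qed.

(** Adding [e] raises the degrees of [u] and [v] by 1, so both must be 1 before. Two nonzero degrees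
    with sum 0 or 2 are exactly that. *)
Lemma regular_setU1 B : e \notin B ->
  regular (e |: B) = [&& contract_regular B, degree B u != 0 & degree B v != 0].
Proof.
move=> eB; have inc x : incidence e x = (x == u) + (x == v) by exact: incidence_pair.
apply/forallP/and3P=> [reg|[/andP[d02 /forall_inP reg] du dv] x].
  have := reg u; have := reg v; rewrite !degree_setU1 // !inc !eqxx (negPf uv).
  rewrite [v == u]eq_sym (negPf uv) !inE => dv du.
  split; [|lia|lia]; apply/andP; split; first by rewrite !inE; lia.
  apply/forall_inP=> x; rewrite eE !inE negb_or => /andP[xu xv].
  by have := reg x; rewrite degree_setU1 // inc (negPf xu) (negPf xv) !inE.
rewrite degree_setU1 // inc; move: d02 (reg x); rewrite eE !inE negb_or.
have [->|xu] := eqVneq x u; first by rewrite (negPf uv); lia.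
by have [->|xv] := eqVneq x v; [lia|move=> _; apply].
Qed.

(** The edge [e] would cover both endpoints, so it is not in [B]. With one degree equal to 0, the
    sum at the merged vertex is the other degree. *)
Lemma regular_degree_eq0 B : (degree B u == 0) || (degree B v == 0) ->
  contract_regular B && (e \notin B) = regular B.
Proof.
move=> d0; have -> : e \notin B.
  by apply: contraTN d0 => eB; rewrite !degree_eq0 negb_or !negbK;
    apply/andP; split; apply/coveredP; exists e; rewrite // eE !inE eqxx ?orbT.
rewrite andbT; apply/andP/forallP=> [[d02 /forall_inP reg] x|reg].
  move: d02 (reg x); rewrite eE !inE negb_or.
  have [->|xu] := eqVneq x u; first by lia.
  by have [->|xv] := eqVneq x v; [lia|move=> _; apply].
split; last by apply/forall_inP=> x _.
by have := reg u; have := reg v; rewrite !inE; lia.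
Qed.

Local Open Scope ring_scope.

Lemma cycle_poly_edge :
  cycle_poly G = cycle_poly (del_edge e) + var_t * cycle_poly (contract e)
    - var_t * cycle_poly (del_verts [set u]) - var_t * cycle_poly (del_verts [set v])
    + var_t * cycle_poly (del_verts [set u; v]).
Proof.
pose du B := degree B u == 0%N; pose dv B := degree B v == 0%N.
have del1 (w : vert G) : cycle_poly (del_verts [set w]) =
    \sum_(B | regular B && (degree B w == 0%N)) weight B.
  rewrite cycle_poly_del_verts; apply: eq_bigl => B; congr (_ && _).
  apply/forall_inP/idP => [-> //|d x]; first exact: set11.
  by move/set1P->.
have del2 : cycle_poly (del_verts [set u; v]) =
    \sum_(B | regular B && (du B && dv B)) weight B.
  rewrite cycle_poly_del_verts; apply: eq_bigl => B; congr (_ && _).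
  apply/forall_inP/andP => [d|[d1 d2] x]; last by case/set2P=> ->.
  by split; apply: d; rewrite !inE eqxx ?orbT.
have con : var_t * cycle_poly (contract e) =
    \sum_(B | regular B && ~~ (e \notin B)) weight B +
    var_t * \sum_(B | regular B && (du B || dv B)) weight B.
  rewrite cycle_poly_contract (bigID (fun B => du B || dv B)) /= mulrDr addrC.
  congr (_ + _).
    (* Sets of nonzero degree at both [u] and [v] correspond to the regular sets containing [e], by
       adding and removing [e]. *)
    rewrite mulr_sumr [RHS](reindex_onto (fun B => e |: B) (fun B => B :\ e)) /=.
      apply: eq_big => B.
        rewrite negbK setU11 andbT.
        have -> : ((e |: B) :\ e == B) = (e \notin B).
          by apply/eqP/idP => [<-|/setU1K //]; rewrite !inE eqxx.
        case: (boolP (e \in B)) => eB.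
          by rewrite !andbF.
        by rewrite regular_setU1 // !andbT negb_or.
      case/andP=> /andP[_ eB]; rewrite /contract_weight => /negPf->.
      by rewrite /weight cardsU1 eB exprS; ring.
    by move=> B /andP[_]; rewrite negbK => /setD1K.
  congr (_ * _); apply: eq_big => B.
    have [d0|] := boolP (du B || dv B); last by rewrite !andbF.
    by rewrite !andbT regular_degree_eq0.
  by case/andP=> _; rewrite /contract_weight => ->.
rewrite {1}/cycle_poly (bigID (fun B => e \notin B)) /= cycle_poly_del_edge.
rewrite con !del1 del2.
(* Inclusion-exclusion on the vanishing of the degrees at [u] and at [v]. *)
have -> : \sum_(B | regular B && (du B || dv B)) weight B =
    \sum_(B | regular B && (degree B u == 0%N)) weight B +
    \sum_(B | regular B && (degree B v == 0%N)) weight B -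
    \sum_(B | regular B && (du B && dv B)) weight B.
  rewrite (bigID du) /= [X in _ + X - _](bigID du) /= addrA [X in X - _]addrAC.
  have -> : \sum_(B | regular B && (degree B v == 0%N) && du B) weight B =
    \sum_(B | regular B && (du B && dv B)) weight B.
    by apply: eq_bigl => B; rewrite -andbA [dv B && _]andbC.
  rewrite addrK; congr (_ + _); apply: eq_bigl => B; rewrite /du /dv;
    by case: (regular B); case: (degree B u == 0%N); case: (degree B v == 0%N).
ring.
Qed.

End Recursion.

(** * Invariance under isomorphism *)

Lemma iso_sym (G H : graph) : iso G H -> iso H G.
Proof.
case=> f [g [[f' fK f'K] [g' gK g'K] E]]; exists f', g'; split.
- by exists f.
- by exists g.
- by move=> e; rewrite -{2}[e]g'K E -imset_comp (eq_imset (g := id)) ?imset_id.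
Qed.

Lemma cycle_poly_iso (G H : graph) : iso G H -> cycle_poly G = cycle_poly H.
Proof.
case=> f [g [f_bij g_bij E]].
have gi (A : {set edge G}) : {in A &, injective g}.
  by move=> x y _ _; apply: bij_inj.
have fi := bij_inj f_bij.
rewrite /cycle_poly [RHS](reindex (fun A : {set edge G} => g @: A)) /=.
  apply: eq_big => A.
    by rewrite (regular_embed (gi A) _ fi).
  by rewrite (weight_embed (gi A) _ fi).
case: g_bij => g' gK g'K; exists (fun B : {set edge H} => g' @: B) => A _.
  by rewrite -imset_comp (eq_imset (g := id)) ?imset_id.
by rewrite -imset_comp (eq_imset (g := id)) ?imset_id.
Qed.

(** * Multiplicativity on disjoint unions *)

Section UnionOfComponents.
Variables (G H : graph) (h : vert G -> vert H) (g : edge G -> edge H).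
Hypotheses (h_inj : injective h) (g_inj : injective g).
Hypothesis g_ends : forall f, ends (g f) = h @: ends f.
Hypothesis g_full : forall f' x, h x \in ends f' -> f' \in codom g.

(** By [g_full], edges outside the image of [g] do not meet the image of [h] and contribute
    nothing. *)
Lemma degree_component (B : {set edge H}) x :
  degree B (h x) = degree (g @^-1: B) x.
Proof.
rewrite -(@degree_embed _ _ h g) => [|? ? _ _|f _|//]; last first.
- exact: g_ends.
- exact: g_inj.
rewrite !degreeE (bigID (mem (codom g))) /= [X in _ + X]big1 ?addn0.
  apply: eq_bigl => f'; apply/andP/imsetP=> [[f'B /codomP[f fE]]|[f + ->]].
    by exists f; rewrite // inE -fE.
  by rewrite inE codom_f.
move=> f' /andP[_ f'g]; apply/eqP; rewrite incidence_eq0.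
by apply: contra f'g; apply: g_full.
Qed.

(** An edge with one end in the image of [h] comes from [G], so its other end is there too. The
    image is thus closed under adjacency, and components can be counted inside it. *)
Lemma ncomp_component (B : {set edge H}) :
  n_comp (sub_adj (spanned B)) [pred y | (y \in covered B) && (y \in codom h)] =
  ncomp (g @^-1: B).
Proof.
have cov x : (h x \in covered B) = (x \in covered (g @^-1: B)).
  by apply: negb_inj; rewrite -!degree_eq0 degree_component.
rewrite (@n_comp_morphism _ _ h (g @^-1: B)).
- by apply: eq_card => x; rewrite !inE codom_f andbT cov.
- apply: (intro_closed (@connect_sub_adj_sym _ _)) => x y xy.
  rewrite !inE -(covered_closed xy) => /andP[-> /codomP[x' xE]] /=.
  case/sub_adjP: xy => f' _ f'E.
  have /codomP[f fE] : f' \in codom g.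
    by apply: (@g_full _ x'); rewrite f'E xE !inE eqxx.
  have : y \in ends f' by rewrite f'E !inE eqxx orbT.
  by rewrite fE g_ends => /imsetP[z _ ->]; apply: codom_f.
- by apply/subsetP=> y /andP[].
- move=> f' x f'B xf' /andP[_ /codomP[x' xE]].
  have /codomP[f fE] : f' \in codom g by apply: (@g_full _ x'); rewrite -xE.
  by exists f; rewrite ?inE -?fE // fE g_ends.
- move=> f x y; rewrite inE => fB xf yf.
  by apply: (connect_ends fB); rewrite g_ends imset_f.
- by move=> x y _ /h_inj->.
Qed.

End UnionOfComponents.

Section Sum.
Variables G1 G2 : graph.
Local Notation G := (gsum G1 G2).
Local Notation el := (inl : edge G1 -> edge G).
Local Notation er := (inr : edge G2 -> edge G).
Local Notation vl := (inl : vert G1 -> vert G).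
Local Notation vr := (inr : vert G2 -> vert G).

Let vl_inj : injective vl. Proof. by move=> x y []. Qed.
Let vr_inj : injective vr. Proof. by move=> x y []. Qed.
Let el_inj : injective el. Proof. by move=> x y []. Qed.
Let er_inj : injective er. Proof. by move=> x y []. Qed.

Let el_full (f : edge G) x : vl x \in ends f -> f \in codom el.
Proof. by case: f => f; [rewrite codom_f|case/imsetP]. Qed.

Let er_full (f : edge G) x : vr x \in ends f -> f \in codom er.
Proof. by case: f => f; [case/imsetP|rewrite codom_f]. Qed.

Lemma degree_gsuml (B : {set edge G}) x : degree B (vl x) = degree (el @^-1: B) x.
Proof. by apply: degree_component => //; apply: el_full. Qed.

Lemma degree_gsumr (B : {set edge G}) x : degree B (vr x) = degree (er @^-1: B) x.
Proof. by apply: degree_component => //; apply: er_full. Qed.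

Lemma regular_gsum (B : {set edge G}) :
  regular B = regular (el @^-1: B) && regular (er @^-1: B).
Proof.
apply/forallP/andP=> [reg|[/forallP reg1 /forallP reg2] [x|x]].
- by split; apply/forallP=> x; rewrite -?degree_gsuml -?degree_gsumr.
- by rewrite degree_gsuml.
- by rewrite degree_gsumr.
Qed.

Lemma ncomp_gsum (B : {set edge G}) :
  ncomp B = ncomp (el @^-1: B) + ncomp (er @^-1: B).
Proof.
rewrite -(ncomp_component vl_inj el_inj _ el_full) //.
rewrite -(ncomp_component vr_inj er_inj _ er_full) //.
(* [n_comp] counts one root per component; the roots are sorted by the summand that contains
   them. *)
rewrite /ncomp /n_comp_mem -(cardID (mem (codom vl))); congr (_ + _).
  by apply: eq_card => y; rewrite !inE -andbA.
apply: eq_card => y; rewrite !inE andbC -andbA; congr (_ && (_ && _)).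
case: y => x; rewrite codom_f; first by apply/esym/codomP=> -[].
by apply/codomP=> -[].
Qed.

Lemma card_gsum (B : {set edge G}) : #|B| = #|el @^-1: B| + #|er @^-1: B|.
Proof.
rewrite -!sum1_card big_sumType /=.
by congr (_ + _); apply: eq_bigl => f; rewrite inE.
Qed.

Local Open Scope ring_scope.

Lemma cycle_poly_gsum : cycle_poly G = cycle_poly G1 * cycle_poly G2.
Proof.
rewrite /cycle_poly big_distrlr pair_big /=.
(* An edge set of the sum amounts to the pair of its traces on the summands, which gives the product
   of the two sums. *)
pose split_edges (B : {set edge G}) := (el @^-1: B, er @^-1: B).
rewrite [RHS](reindex split_edges) /=.
  apply: eq_big => B; first exact: regular_gsum.
  by move=> _; rewrite /weight ncomp_gsum card_gsum !exprD; ring.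
exists (fun p : {set edge G1} * {set edge G2} => el @: p.1 :|: er @: p.2)
  => [B _|[A1 A2] _].
  apply/setP=> -[f|f]; rewrite !inE /=.
    rewrite mem_imset // inE; case: imsetP => [[? //]|_]; exact: orbF.
  by rewrite mem_imset // inE; case: imsetP => [[? //]|_].
congr pair; apply/setP=> f; rewrite !inE mem_imset //=.
  by case: imsetP => [[? //]|_]; rewrite orbF.
by case: imsetP => [[? //]|_].
Qed.

End Sum.

(** * The empty graph and the bouquets *)

Lemma weight_set0 (G : graph) : weight (set0 : {set edge G}) = 1%R.
Proof.
rewrite /weight cards0 /ncomp /n_comp_mem /covered big_set0 eq_card0 ?mul1r //.
by move=> x; rewrite !inE andbF.
Qed.

Lemma regular_set0 (G : graph) : regular (set0 : {set edge G}).
Proof. by apply/forallP=> x; rewrite degreeE big_set0. Qed.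

Lemma cycle_poly_empty : cycle_poly empty_graph = 1%R.
Proof.
rewrite /cycle_poly (bigD1 set0) ?regular_set0 //= weight_set0 big1 ?addr0 //.
by move=> B /andP[_ /set0Pn[[]]].
Qed.

Lemma cycle_poly_K1 n : cycle_poly (K1 n) = (1 + n%:R * var_s * var_t)%R.
Proof.
(* Each loop adds 2 to the degree of the vertex, so at most one can be chosen. The empty set gives 1
   and each of the [n] singletons gives [var_s * var_t]. *)
have reg (B : {set edge (K1 n)}) : regular B = (#|B| <= 1).
  have deg : degree B tt = 2 * #|B|.
    rewrite degreeE -sum1_card big_distrr /=; apply: eq_bigr => f _.
    by rewrite /incidence /= cards1 inE.
  apply/forallP/idP => [/(_ tt)|c []]; rewrite deg !inE; first by lia.
  by case: #|B| c => [|[]].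
rewrite /cycle_poly (bigD1 set0) ?regular_set0 //= weight_set0; congr (_ + _)%R.
rewrite (eq_bigl (mem [set B : {set edge (K1 n)} | #|B| == 1])); last first.
  by move=> B; rewrite reg !inE -card_gt0; case: #|B| => [|[]].
rewrite (eq_bigr (fun _ => var_s * var_t)%R) => [|B].
  by rewrite sumr_const card_draws card_ord bin1 -mulrA mulr_natl.
rewrite !inE => /cards1P[i ->]; rewrite /weight cards1 expr1.
suff -> : ncomp [set i] = 1 by rewrite expr1.
rewrite /ncomp /covered big_set1 /= /n_comp_mem -(cards1 tt).
by apply: eq_card => -[]; rewrite !inE.
Qed.

Lemma cycle_poly_recursion : cycle_recursion cycle_poly.
Proof.
split=> [G e u v|G G1 G2 _ _|G n|G].
- exact: cycle_poly_edge.
- by move/cycle_poly_iso->; apply: cycle_poly_gsum.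
- by move/cycle_poly_iso->; apply: cycle_poly_K1.
- by move/cycle_poly_iso->; apply: cycle_poly_empty.
Qed.

(** * Coefficients as numbers of cycles *)

Lemma is_cycleE (G : graph) k l (S : {set vert G} * {set edge G}) :
  is_cycle k l S =
  (S \in @spanned G @: [set B | [&& regular B, ncomp B == k & #|B| == l]]).
Proof.
apply/and4P/imsetP => [[/forall_inP sub /forall_inP deg nk nl]|[B + ->]].
  (* Degree 2 forces every vertex of [S.1] to lie on an edge of [S.2], so the vertex set is
     recovered from the edges. *)
  have covS : S.1 = covered S.2.
    apply/setP=> x; apply/idP/coveredP=> [/deg dx|[f /sub/subsetP]]; last exact.
    apply/coveredP; rewrite -[_ \in _]negbK -degree_eq0.
    by have /eqP-> : degree S.2 x == 2 := dx.
  have SE : S = spanned S.2 by rewrite /spanned -covS; case: (S).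
  exists S.2 => //; rewrite inE {1}/ncomp -SE -covS nk nl !andbT.
  apply/forallP=> x; rewrite !inE degree_eq0 -covS.
  by case: (boolP (x \in S.1)) => //= /deg; rewrite SE.
rewrite inE => /and3P[/forallP reg nk nl]; split=> //.
  by apply/forall_inP=> f fB; apply/subsetP=> x xf; apply/coveredP; exists f.
apply/forall_inP=> x xB; have := reg x.
by rewrite !inE degree_eq0 xB.
Qed.

Lemma coef_cycle_poly (G : graph) k l :
  mcoeff [multinom [tuple k; l]] (cycle_poly G) = Posz (cycle_count G k l).
Proof.
(* Each weight is a single monomial, so it contributes 0 or 1 to a given coefficient. *)
have weightE (B : {set edge G}) :
    weight B = 'X_[[multinom [tuple ncomp B; #|B|]]]%R.
  rewrite mpolyXE_id big_ord_recl big_ord1 /weight /var_s /var_t.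
  by congr (_ * _)%R; congr ('X_ _ ^+ _)%R; apply: val_inj.
have mnm_eq a b c d : ([multinom [tuple a; b]] == [multinom [tuple c; d]]) =
    (a == c) && (b == d).
  by rewrite -val_eqE /= -val_eqE /= !eqseq_cons andbT.
have -> : cycle_count G k l =
    #|[set B : {set edge G} | [&& regular B, ncomp B == k & #|B| == l]]|.
  rewrite -(card_imset _ (_ : injective (@spanned G))); last by move=> B B' [].
  by apply: eq_card => S; rewrite inE is_cycleE.
rewrite /cycle_poly raddf_sum /= (eq_bigr (fun B : {set edge G} =>
  ((ncomp B == k) && (#|B| == l))%:R%R)); last first.
  by move=> B _; rewrite weightE mcoeffX mnm_eq.
rewrite -natr_sum natz -sum1_card big_mkcond [in RHS]big_mkcond /=; congr Posz.
by apply: eq_bigr => B _; rewrite inE; case: (regular B) => //=; case: (_ && _).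
Qed.

(** * Uniqueness by induction on vertices and edges *)

Lemma iso_gsum_del_verts (G : graph) (D : {set vert G}) :
  (forall f, (ends f \subset D) || (ends f \subset ~: D)) ->
  iso G (gsum (del_verts D) (del_verts (~: D))).
Proof.
move=> sepD; apply: iso_sym; set H := gsum _ _.
pose h (y : vert H) : vert G := match y with inl x => val x | inr x => val x end.
pose g (f : edge H) : edge G := match f with inl f => val f | inr f => val f end.
(* No edge lies on both sides, because every edge has an end; this keeps [g] injective. *)
have excl f : ends f \subset D -> ends f \subset ~: D -> False.
  have /andP[/card_gt0P[x xf] _] := endsP f.
  by move=> /subsetP/(_ x xf) xD /subsetP/(_ x xf); rewrite inE xD.
exists h, g; split.
- apply: inj_card_bij => [[x|x] [y|y] /= E|].
  + by congr inl; apply: val_inj.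
  + by have := valP x; have := valP y; rewrite /= E inE negbK => ->.
  + by have := valP x; have := valP y; rewrite /= E inE negbK => /negPf->.
  + by congr inr; apply: val_inj.
  rewrite card_sum !card_sig -(cardC (mem D)) addnC leq_eqVlt; apply/orP; left.
  apply/eqP; congr (_ + _); apply: eq_card => x; rewrite !inE ?negbK //.
- apply: inj_card_bij => [[x|x] [y|y] /= E|].
  + by congr inl; apply: val_inj.
  + have := valP x; have := valP y; rewrite /= E !disjoints_subset setCK.
    by move=> a /(excl _ a).
  + have := valP x; have := valP y; rewrite /= E !disjoints_subset setCK.
    by move=> a b; case: (excl _ b a).
  + by congr inr; apply: val_inj.
  rewrite card_sum !card_sig -(cardC [pred f | ends f \subset D]) addnC.
  rewrite leq_eqVlt; apply/orP; left; apply/eqP; congr (_ + _); apply: eq_card => f.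
    rewrite !inE disjoints_subset; have := sepD f; have := @excl f.
    by case: (_ \subset D); case: (_ \subset _) => // /(_ isT isT).
  by rewrite !inE disjoints_subset setCK.
- by case=> f; rewrite /= -imset_comp ends_del_verts.
Qed.

(** Every edge has an end, so without vertices there are no edges either. *)
Lemma iso_empty (G : graph) : #|vert G| = 0 -> iso G empty_graph.
Proof.
move/card0_eq => card0; have V0 (x : vert G) : False by have := card0 x.
have E0 (f : edge G) : False by have /andP[/card_gt0P[x _]] := endsP f; case: (V0 x).
exists (fun x => False_rect void (V0 x)), (fun f => False_rect void (E0 f)).
split=> [||f]; last by case: (E0 f).
  by apply: inj_card_bij => [x|]; [case: (V0 x)|rewrite card_void].
by apply: inj_card_bij => [f|]; [case: (E0 f)|rewrite card_void].
Qed.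

Lemma iso_K1 (G : graph) : #|vert G| = 1 -> iso G (K1 #|edge G|).
Proof.
move=> V1; exists (fun _ => tt), enum_rank; split=> [||f].
- apply: inj_card_bij; last by rewrite card_unit V1.
  have /fintype_le1P eqV : #|vert G| <= 1 by rewrite V1.
  by move=> x y _; rewrite (eqV y x).
- exact: enum_rank_bij.
- apply/setP=> -[]; rewrite inE eqxx; apply/esym/imsetP.
  by have /andP[/card_gt0P[x xf] _] := endsP f; exists x.
Qed.

Lemma card_sig_notin (T : finType) (D : {set T}) :
  #|{: {x | x \notin D}}| = #|~: D|.
Proof. by rewrite card_sig; apply: eq_card => x; rewrite !inE. Qed.

Lemma card_del_verts (G : graph) (D : {set vert G}) :
  D != set0 ->
  #|vert (del_verts D)| + #|edge (del_verts D)| < #|vert G| + #|edge G|.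
Proof.
rewrite -card_gt0 => D0; rewrite /= card_sig_notin card_sig -addSn leq_add ?max_card //.
by rewrite -(cardsC D) -add1n leq_add2r.
Qed.

Lemma cycle_recursion_unique C C' (G : graph) :
  cycle_recursion C -> cycle_recursion C' -> C G = C' G.
Proof.
move=> [edgeC sumC bouqC emptyC] [edgeC' sumC' bouqC' emptyC'].
have [n] := ubnP (#|vert G| + #|edge G|); elim: n G => // n IHn G; rewrite ltnS => Gn.
have IH H : #|vert H| + #|edge H| < #|vert G| + #|edge G| -> C H = C' H.
  by move=> HG; apply: IHn; apply: leq_trans HG _.
have [/existsP[e /cards2P[u [v [uv eE]]]]|/existsPn loops] :=
  boolP [exists e : edge G, #|ends e| == 2].
  have cardE : #|{: {f : edge G | f != e}}| < #|edge G|.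
    by rewrite card_sig [X in _ < X](cardD1 e) inE add1n ltnS subset_leq_card //;
      apply/subsetP=> f; rewrite !inE andbT.
  (* Contraction replaces the nonempty set [ends e] by one vertex, so the vertex count does not
     grow; the strict decrease comes from the edges. *)
  have cardV : #|{: option {x | x \notin ends e}}| <= #|vert G|.
    by rewrite card_option card_sig_notin -(cardsC (ends e)) -add1n leq_add2r;
      case/andP: (endsP e).
  have un0 : [set u] != set0 by apply/set0Pn; exists u; rewrite set11.
  have vn0 : [set v] != set0 by apply/set0Pn; exists v; rewrite set11.
  have uvn0 : [set u; v] != set0 by apply/set0Pn; exists u; rewrite set21.
  rewrite (edgeC G e u v) // (edgeC' G e u v) //.
  by rewrite !IH ?card_del_verts //= ?ltn_add2l // -addnS leq_add.
have [V0|Vpos] := posnP #|vert G|.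
  by rewrite emptyC ?emptyC' //; apply: iso_empty.
have [V1|V2] := eqVneq #|vert G| 1.
  by rewrite (bouqC _ _ (iso_K1 V1)) (bouqC' _ _ (iso_K1 V1)).
have /card_gt0P[x _] := Vpos.
(* Only loops remain, so [x] with its loops is separated from the rest of [G]. *)
have sep f : (ends f \subset [set x]) || (ends f \subset ~: [set x]).
  have /cards1P[y ->] : #|ends f| == 1.
    by have := loops f; have := endsP f; lia.
  by rewrite !sub1set !inE orbN.
have isoG := iso_gsum_del_verts sep.
have cardx := cardsC [set x]; rewrite cards1 in cardx.
(* As [G] has at least two vertices, [[set x]] and its complement are both nonempty: each summand
   has a vertex, and each is smaller than [G]. *)
have pos1 : 0 < #|vert (del_verts [set x])| by rewrite /= card_sig_notin; lia.
have pos2 : 0 < #|vert (del_verts (~: [set x]))|.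
  by rewrite /= card_sig_notin setCK cards1.
rewrite (sumC _ _ _ pos1 pos2 isoG) (sumC' _ _ _ pos1 pos2 isoG).
rewrite !IH ?card_del_verts // -card_gt0 ?cards1 //.
by rewrite /= card_sig_notin in pos1.
Qed.

Theorem theorem3 :
  (exists! C : graph -> {mpoly int[2]}, cycle_recursion C) /\
  (forall C : graph -> {mpoly int[2]}, cycle_recursion C ->
     forall (G : graph) (k l : nat),
       mcoeff [multinom [tuple k; l]] (C G) = Posz (cycle_count G k l)).
Proof.
split.
  exists cycle_poly; split; first exact: cycle_poly_recursion.
  move=> C recC; apply: functional_extensionality => G.
  exact: cycle_recursion_unique cycle_poly_recursion recC.
move=> C recC G k l.
by rewrite (cycle_recursion_unique G recC cycle_poly_recursion) coef_cycle_poly.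
Qed.
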